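(* Let $$\mathbf{T}=\left(\mathbf{I}-\mathbf{P}^{-1}\mathbf{M}\right)\left(\mathbf{I}-\mathbf{T}_C^F\,\tilde{\mathbf{P}}^{-1}\,\mathbf{T}_F^C\,\mathbf{M}\right),$$ where $\mathbf{M}$ is the time-periodic composite collocation matrix, $\mathbf{P},\tilde{\mathbf{P}}$ are the (invertible) time-periodic fine and coarse preconditioners (built with the circulant matrix $\hat{\mathbf{E}}$), and $\mathbf{T}_C^F,\mathbf{T}_F^C$ are circulant interweaved transfer operators in space, all as defined in the context, with the spatial matrices $A$ and $\tilde A$ diagonalized by the Fourier matrices $\boldsymbol\Psi$ and $\boldsymbol\Psi_C$, respectively. Then there exists a transformation (invertible matrix) $\hat{\mathcal{F}}$ such that $$\hat{\mathcal{F}}^{-1}\mathbf{T}\hat{\mathcal{F}}=\mathrm{diag}\left(\mathcal{B}^{(S)}_{0,0}\mathcal{B}^{(CGC)}_{0,0},\ \mathcal{B}^{(S)}_{0,1}\mathcal{B}^{(CGC)}_{0,1},\ \ldots,\ \mathcal{B}^{(S)}_{\frac N2-1,L-1}\mathcal{B}^{(CGC)}_{\frac N2-1,L-1}\right),$$ with $2M\times2M$ blocks $$\mathcal{B}^{(S)}_{k,j}=\begin{pmatrix}\mathbf{I}-\left(\mathbf{B}^{(P)}_{k,j}\right)^{-1}\mathbf{B}^{(M)}_{k,j}&0\\0&\mathbf{I}-\left(\mathbf{B}^{(P)}_{\frac N2+k,j}\right)^{-1}\mathbf{B}^{(M)}_{\frac N2+k,j}\end{pmatrix},$$ $$\mathcal{B}^{(CGC)}_{k,j}=\begin{pmatrix}\mathbf{I}-f_kd_k\left(\mathbf{B}^{(\tilde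 P)}_{k,j}\right)^{-1}\mathbf{B}^{(M)}_{k,j}&-\hat f_kd_k\left(\mathbf{B}^{(\tilde P)}_{k,j}\right)^{-1}\mathbf{B}^{(M)}_{\frac N2+k,j}\\-\hat d_kf_k\left(\mathbf{B}^{(\tilde P)}_{k,j}\right)^{-1}\mathbf{B}^{(M)}_{k,j}&\mathbf{I}-\hat f_k\hat d_k\left(\mathbf{B}^{(\tilde P)}_{k,j}\right)^{-1}\mathbf{B}^{(M)}_{\frac N2+k,j}\end{pmatrix},$$ for $k=0,\ldots,\frac N2-1$ and $j=0,\ldots,L-1$. Here the $M\times M$ blocks depend, as far as the spatial problem is concerned, solely on the eigenvalues of $A$ and $\tilde A$: up to a permutation, the Fourier transformation in the time-subinterval and space layers transforms $\mathbf{P}$, $\mathbf{M}$ and $\tilde{\mathbf{P}}$ by similarity into $\mathrm{diag}(\mathbf{B}^{(P)}_{0,0},\ldots,\mathbf{B}^{(P)}_{N-1,L-1})$, $\mathrm{diag}(\mathbf{B}^{(M)}_{0,0},\ldots,\mathbf{B}^{(M)}_{N-1,L-1})$ and $\mathrm{diag}(\mathbf{B}^{(\tilde P)}_{0,0},\ldots,\mathbf{B}^{(\tilde P)}_{\frac N2-1,L-1})$, where $$\mathbf{B}^{(P)}_{k,j}=\mathbf{I}-\lambda^{(A)}_k\Delta t\,\mathbf{Q}_\Delta-\exp\left(-i2\pi\tfrac jL\right)\mathbf{N}_M,$$ $$\mathbf{B}^{(M)}_{k,j}=\mathbf{I}-\lambda^{(A)}_k\Delta t\,\mathbf{Q}-\exp\left(-i2\pi\tfrac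 jL\right)\mathbf{N}_M,$$ $$\mathbf{B}^{(\tilde P)}_{k,j}=\mathbf{I}-\lambda^{(\tilde A)}_k\Delta t\,\mathbf{Q}_\Delta-\exp\left(-i2\pi\tfrac jL\right)\mathbf{N}_M .$$
   Context: Let $N$ be even (number of fine spatial grid points on a periodic grid), $M$ the number of quadrature nodes per subinterval, $L$ the number of subintervals, $\Delta t>0$ the length of a subinterval. $\mathbf{Q}\in\mathbb{R}^{M\times M}$ is the quadrature matrix ($\Delta t\,\mathbf{Q}_{ij}=\int_{t_l}^{\tau_i}\ell_j(s)\,ds$ with $\ell_j$ the Lagrange polynomials of the nodes $\tau_1<\cdots<\tau_M=t_{l+1}$ in $[t_l,t_{l+1}]$; the nodes have the same relative positions on every subinterval), and $\mathbf{Q}_\Delta\in\mathbb{R}^{M\times M}$ is a lower triangular matrix approximating $\mathbf{Q}$. $\mathbf{N}_M\in\mathbb{R}^{M\times M}$ has ones in its last column and zeros elsewhere. $\hat{\mathbf{E}}\in\mathbb{R}^{L\times L}$ has ones on the first subdiagonal, a one in the upper right corner, and zeros elsewhere (cyclic shift). Fourier matrices: $\boldsymbol\Psi\in\mathbb{C}^{N\times N}$ is the unitary matrix with columns $\psi_k=\frac1{\sqrt N}\left(\exp(i\frac{2\pi}{N}kj)\right)_{j=0}^{N-1}$, $k=0,\ldots,N-1$; $\boldsymbol\Psi_C\in\mathbb{C}^{N/2\times N/2}$ is the analogous matrix for $N/2$ points, and in the subinterval layer the analogous matrix for $L$ points is used. Spatial matrices: $A\in\mathbb{R}^{N\times N}$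 and $\tilde A\in\mathbb{R}^{N/2\times N/2}$ are circulant (periodic problem; only space is coarsened, the same spatial operator is used on every subinterval), with eigenvalues $\lambda^{(A)}_k$ belonging to $\psi_k$ ($A\psi_k=\lambda_k^{(A)}\psi_k$), and $\lambda^{(\tilde A)}_k$ belonging to the $k$-th column of $\boldsymbol\Psi_C$. System matrix and preconditioners: $\mathbf{M}=\mathbf{I}_L\otimes\mathbf{I}_M\otimes\mathbf{I}_N-\Delta t\,\mathbf{I}_L\otimes\mathbf{Q}\otimes A-\hat{\mathbf{E}}\otimes\mathbf{N}_M\otimes\mathbf{I}_N$, $\mathbf{P}=\mathbf{I}_L\otimes\mathbf{I}_M\otimes\mathbf{I}_N-\Delta t\,\mathbf{I}_L\otimes\mathbf{Q}_\Delta\otimes A-\hat{\mathbf{E}}\otimes\mathbf{N}_M\otimes\mathbf{I}_N$, $\tilde{\mathbf{P}}=\mathbf{I}_L\otimes\mathbf{I}_M\otimes\mathbf{I}_{N/2}-\Delta t\,\mathbf{I}_L\otimes\mathbf{Q}_\Delta\otimes\tilde A-\hat{\mathbf{E}}\otimes\mathbf{N}_M\otimes\mathbf{I}_{N/2}$. Transfer operators: for $X,Y\in\mathbb{R}^{n\times n}$ let $\mathcal{W}(X,Y)\in\mathbb{R}^{2n\times n}$ be the matrix whose rows are, in order, row 1 of $X$, row 1 of $Y$, row 2 of $X$, row 2 of $Y$, ..., row $n$ of $X$, row $n$ of $Y$. A CI-interpolation (circulant interweaved interpolation) is a matrix $\mathcal{W}(\mathbf{I}_{N/2},C)$ with $C\in\mathbb{R}^{N/2\times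 N/2}$ circulant and $C\mathbf{1}=\mathbf{1}$. A CI-restriction is a matrix $R\in\mathbb{R}^{N/2\times N}$ such that $c\,R^T$ is a CI-interpolation for some $c\in\mathbb{R}$. Here $\mathbf{T}_C^F=\mathbf{I}_L\otimes\mathbf{I}_M\otimes S$ with $S$ a CI-interpolation and $\mathbf{T}_F^C=\mathbf{I}_L\otimes\mathbf{I}_M\otimes R$ with $R$ a CI-restriction (possibly built from a different circulant matrix). The scalars $d_k,\hat d_k,f_k,\hat f_k$, $k=0,\ldots,N/2-1$, are the entries of the transformed operators $\boldsymbol\Psi^*S\boldsymbol\Psi_C=\begin{pmatrix}\mathrm{diag}(d_0,\ldots,d_{N/2-1})\\ \mathrm{diag}(\hat d_0,\ldots,\hat d_{N/2-1})\end{pmatrix}$ and $\boldsymbol\Psi_C^*R\boldsymbol\Psi=\begin{pmatrix}\mathrm{diag}(f_0,\ldots,f_{N/2-1})&\mathrm{diag}(\hat f_0,\ldots,\hat f_{N/2-1})\end{pmatrix}$ (both matrices have this form). *)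

(* Defs.v *)
(* The complex numbers are R[i] for R : realType.  A *t B is the Kronecker
   product, with row index (i1, i2) |-> i1 * m2 + i2 and likewise for columns;
   *t associates to the left.  A periodic grid with an even number N of points
   is rendered by N = n + n, so that N / 2 = n. *)
From HB Require Import structures.
From mathcomp Require Import all_boot all_order all_algebra perm.
From mathcomp Require Import all_classical all_reals all_analysis.
From mathcomp Require Import complex mxtens.

Set Implicit Arguments.
Unset Strict Implicit.
Unset Printing Implicit Defensive.

Import Order.TTheory GRing.Theory Num.Theory.
Import numFieldNormedType.Exports.

Local Open Scope ring_scope.
Local Open Scope complex_scope.
Local Open Scope classical_set_scope.

Section Quadrature.
Variable R : realType.

(* left endpoint of the l-th subinterval [t_l, t_(l+1)] *)
Definition subinterval_start (t0 dt : R) (l : nat) : R := t0 + l%:R * dt.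

Definition lagrange (M : nat) (tau : 'I_M -> R) (j : 'I_M) (s : R) : R :=
  \prod_(i < M | i != j) ((s - tau i) / (tau j - tau i)).

Definition quadrature_nodes (L M : nat) (t0 dt : R) (tau : 'I_L -> 'I_M -> R) :
    Prop :=
  let t := subinterval_start t0 dt in
  [/\ forall (l : 'I_L) (i j : 'I_M), (i < j)%N -> tau l i < tau l j,
      forall (l : 'I_L) i, t l <= tau l i <= t l.+1,
      forall (l : 'I_L) (i : 'I_M), i.+1 = M -> tau l i = t l.+1
    & forall (l l' : 'I_L) i, tau l i - t l = tau l' i - t l'].

Definition quadrature_matrix (L M : nat) (t0 dt : R) (tau : 'I_L -> 'I_M -> R)
    (Q : 'M[R]_M) : Prop :=
  forall (l : 'I_L) (i j : 'I_M),
    dt * Q i j =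
    \int[lebesgue_measure]_(s in `[subinterval_start t0 dt l, tau l i])
       lagrange (tau l) j s.

End Quadrature.

Section Matrices.
Variable R : pzRingType.

Definition last_col_mx (M : nat) : 'M[R]_M :=
  \matrix_(i, j) ((j.+1 == M)%:R).

(* for L = 1 the upper right corner is the only entry, which is then 1 *)
Definition cyclic_shift_mx (L : nat) : 'M[R]_L :=
  \matrix_(i, j) (((i == j.+1 :> nat) || ((i == 0%N :> nat) && (j.+1 == L)))%:R).

Definition circulant (n : nat) (C : 'M[R]_n) : Prop :=
  exists c : nat -> R, forall i j : 'I_n, C i j = c ((i + n - j) %% n)%N.

Lemma half_ord_subproof (n : nat) (i : 'I_(n + n)) : (i./2 < n)%N.
Proof. by rewrite ltn_half_double -addnn. Qed.

Definition half_ord (n : nat) (i : 'I_(n + n)) : 'I_n :=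
  Ordinal (half_ord_subproof i).

(* rows are numbered from 0, so even rows come from X and odd rows from Y *)
Definition interweave (n : nat) (X Y : 'M[R]_n) : 'M[R]_(n + n, n) :=
  \matrix_(i, j) (if odd i then Y (half_ord i) j else X (half_ord i) j).

Definition CI_interpolation (n : nat) (S : 'M[R]_(n + n, n)) : Prop :=
  exists C : 'M[R]_n,
    [/\ circulant C, C *m (const_mx 1 : 'cV[R]_n) = const_mx 1
      & S = interweave 1%:M C].

Definition CI_restriction (n : nat) (S : 'M[R]_(n, n + n)) : Prop :=
  exists c : R, CI_interpolation (c *: S^T).

End Matrices.

Arguments last_col_mx {R} M.
Arguments cyclic_shift_mx {R} L.

Section Iteration.
Variable R : realType.

(* With q := Q and a := A this is the composite collocation matrix, with
   q := Q_Delta and a := A (resp. the coarse operator) the fine (resp. coarse)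
   preconditioner. *)
Definition composite_mx (L M N : nat) (dt : R) (q : 'M[R]_M) (a : 'M[R]_N) :
    'M[R]_(L * M * N) :=
  (1%:M : 'M[R]_L) *t (1%:M : 'M[R]_M) *t (1%:M : 'M[R]_N)
  - dt *: ((1%:M : 'M[R]_L) *t q *t a)
  - (cyclic_shift_mx L : 'M[R]_L) *t (last_col_mx M : 'M[R]_M) *t (1%:M : 'M[R]_N).

Definition space_transfer (L M m n : nat) (S : 'M[R]_(m, n)) :
    'M[R]_(L * M * m, L * M * n) :=
  (1%:M : 'M[R]_L) *t (1%:M : 'M[R]_M) *t S.

Definition iteration_mx (L M n : nat) (dt : R) (Q QD : 'M[R]_M)
    (A : 'M[R]_(n + n)) (At : 'M[R]_n)
    (S : 'M[R]_(n + n, n)) (Rst : 'M[R]_(n, n + n)) :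
    'M[R]_(L * M * (n + n)) :=
  let Mx := composite_mx L dt Q A in
  let P := composite_mx L dt QD A in
  let Pt := composite_mx L dt QD At in
  (1%:M - invmx P *m Mx)
  *m (1%:M - space_transfer L M S *m invmx Pt *m space_transfer L M Rst *m Mx).

End Iteration.

Section Fourier.
Variable R : realType.
Local Notation C := R[i].

(* exp (i theta) *)
Definition expi (theta : R) : C := cos theta +i* sin theta.

Definition toC (m n : nat) (X : 'M[R]_(m, n)) : 'M[C]_(m, n) :=
  map_mx (real_complex R) X.

Definition adjoint_mx (m n : nat) (X : 'M[C]_(m, n)) : 'M[C]_(n, m) :=
  map_mx conjc X^T.

Definition fourier_mx (N : nat) : 'M[C]_N :=
  \matrix_(j, k)
    (((Num.sqrt (N%:R : R))^-1)%:C * expi (2 * pi / N%:R * k%:R * j%:R)).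

Definition fourier_layers (L M N : nat) : 'M[C]_(L * M * N) :=
  fourier_mx L *t (1%:M : 'M[C]_M) *t fourier_mx N.

Definition interp_symbol (n : nat) (S : 'M[R]_(n + n, n)) : 'M[C]_(n + n, n) :=
  adjoint_mx (fourier_mx (n + n)) *m toC S *m fourier_mx n.

Definition restr_symbol (n : nat) (Rst : 'M[R]_(n, n + n)) :
    'M[C]_(n, n + n) :=
  adjoint_mx (fourier_mx n) *m toC Rst *m fourier_mx (n + n).

(* the diagonal entries d_k, \hat d_k, f_k, \hat f_k of the n x n blocks of
   the transformed transfer operators *)
Definition interp_d (n : nat) (S : 'M[R]_(n + n, n)) (k : 'I_n) : C :=
  interp_symbol S (lshift n k) k.
Definition interp_dhat (n : nat) (S : 'M[R]_(n + n, n)) (k : 'I_n) : C :=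
  interp_symbol S (rshift n k) k.
Definition restr_f (n : nat) (Rst : 'M[R]_(n, n + n)) (k : 'I_n) : C :=
  restr_symbol Rst k (lshift n k).
Definition restr_fhat (n : nat) (Rst : 'M[R]_(n, n + n)) (k : 'I_n) : C :=
  restr_symbol Rst k (rshift n k).

(* B^(P), B^(M) or B^(Pt), according to the choice of q and lambda *)
Definition time_block (L M : nat) (dt : R) (q : 'M[R]_M) (lambda : C)
    (j : 'I_L) : 'M[C]_M :=
  1%:M - (lambda * dt%:C) *: toC q
       - expi (- (2 * pi * (j%:R / L%:R))) *: last_col_mx M.

Definition smoother_block (M : nat) (BP0 BM0 BP1 BM1 : 'M[C]_M) :
    'M[C]_(M + M) :=
  block_mx (1%:M - invmx BP0 *m BM0) 0
           0 (1%:M - invmx BP1 *m BM1).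

Definition cgc_block (M : nat) (d dhat f fhat : C) (BPt BM0 BM1 : 'M[C]_M) :
    'M[C]_(M + M) :=
  block_mx (1%:M - (f * d) *: (invmx BPt *m BM0))
           (- ((fhat * d) *: (invmx BPt *m BM1)))
           (- ((dhat * f) *: (invmx BPt *m BM0)))
           (1%:M - (fhat * dhat) *: (invmx BPt *m BM1)).

(* diag (B 0 0, B 0 1, ..., B 0 (L-1), B 1 0, ..., B (K-1) (L-1)); the cast
   identifies the sum of the block sizes with the size D of the matrix *)
Definition diag_blocks (K L m D : nat) (e : (\sum_(i < K * L) m)%N = D)
    (B : 'I_K -> 'I_L -> 'M[C]_m) : 'M[C]_D :=
  castmx (e, e)
    (\mxdiag_(i < K * L) B (mxtens_unindex i).1 (mxtens_unindex i).2).

Lemma layers_dim (L M N : nat) : (\sum_(i < N * L) M)%N = (L * M * N)%N.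
Proof. by rewrite sum_nat_const card_ord -mulnA mulnC. Qed.

Lemma pairs_dim (L M n : nat) :
  (\sum_(i < n * L) (M + M))%N = (L * M * (n + n))%N.
Proof. by rewrite sum_nat_const card_ord !mulnDr -mulnA mulnC. Qed.

(* for an invertible F, F^-1 X F = Y *)
Definition transforms_into (n : nat) (F X Y : 'M[C]_n) : Prop :=
  F \in unitmx /\ invmx F *m X *m F = Y.

End Fourier.

(* Main.v *)
Require Import Defs.
From HB Require Import structures.
From mathcomp Require Import all_boot all_order all_algebra perm.
From mathcomp Require Import all_classical all_reals all_analysis.
From mathcomp Require Import complex mxtens ring lra.

Set Implicit Arguments.
Unset Strict Implicit.
Unset Printing Implicit Defensive.

Import Order.TTheory GRing.Theory Num.Theory.
Import numFieldNormedType.Exports.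

Local Open Scope ring_scope.
Local Open Scope complex_scope.

(** Everything that occurs in the iteration is a Kronecker product over the
    three layers subinterval x node x space, so the Fourier matrices act on
    the subinterval and space layers without touching the node layer. Write F
    for the resulting transformation on the fine grid.

    A circulant matrix has the Fourier columns as eigenvectors
    (circulant_fourier); this applies to the cyclic shift, whose eigenvalues
    exp (-2 i pi j / L) produce the N_M term of the time blocks, and it is
    given for A and its coarse version. Hence X F = F X' for each of the
    composite matrices, where X' only couples indices that share the same
    frequency k and the same j, and there acts as an M x M time block
    (composite_fourier).

    The transfer operators mix frequencies, but only by aliasing. Up to the
    normalization, and with columns taken modulo n, row 2i of the fine Fourier
    matrix is row i of the coarse one, and row 2i + 1 differs from row 2i by a
    phase depending on the column alone; therefore the inner
    product of a fine column k' with an interpolated coarse column k is a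
    multiple of the inner product of two coarse Fourier columns, zero unless
    k' = k modulo n (interp_symbol_eq0). So S couples the coarse frequency k
    only to the fine frequencies k and n + k, and R, being a multiple of the
    transpose of such an S, has the adjoint pattern (restr_symbolE).

    If one groups the fine indices by (k, j), k < n, putting the harmonics k
    and n + k in the same group of size 2M, all the transformed operators,
    rectangular ones included, are block diagonal for the same grouping
    (block_family). Such matrices are multiplied and inverted blockwise
    (block_familyM, block_familyV), so the transformed iteration is block
    diagonal too, and its blocks are computed from 2M x 2M matrices
    (two_grid_blockE). It remains to reorder the indices so that the groups
    become contiguous, which is a permutation (perm_block_family). All
    similarities are handled in the form X F = F Y, in which they compose and
    also make sense for rectangular X. *)

(** * Block diagonal matrices for an arbitrary grouping of the indices *)

Section BlockFamily.
Variables (K : fieldType) (T : finType).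

(** The maps g and h give each row and column index its group in T and its
    position within the group. Leaving them arbitrary lets one notion cover
    the layered ordering of the indices, the pairing of harmonics, the
    contiguous ordering of diag_blocks, and the transfers between grids. *)
Definition block_family p q D E (g : 'I_D -> T * 'I_p) (h : 'I_E -> T * 'I_q)
    (B : T -> 'M[K]_(p, q)) : 'M[K]_(D, E) :=
  \matrix_(i, j)
    if (g i).1 == (h j).1 then B (g i).1 (g i).2 (h j).2 else 0.

Lemma block_familyM p q r D E H (g : 'I_D -> T * 'I_p) (h : 'I_E -> T * 'I_q)
    (u : 'I_H -> T * 'I_r) (B : T -> 'M[K]_(p, q)) (B' : T -> 'M[K]_(q, r)) :
  bijective h ->
  block_family g h B *m block_family h u B' =
  block_family g u (fun t => B t *m B' t).
Proof.
case=> h' hK h'K; apply/matrixP => i j; rewrite !mxE.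
rewrite (reindex h'); last by apply: onW_bij; exists h.
under eq_bigr => y _ do rewrite !mxE h'K.
rewrite -(pair_bigA _ (fun t x =>
  (if (g i).1 == t then B (g i).1 (g i).2 x else 0) *
  (if t == (u j).1 then B' t x (u j).2 else 0))) /=.
rewrite (bigD1 (g i).1) //= [X in _ + X]big1 => [|t ti]; last first.
  by apply: big1 => x _; rewrite eq_sym (negPf ti) mul0r.
rewrite addr0 eqxx; case: ifP => // _.
by apply: big1 => x _; rewrite mulr0.
Qed.

Lemma block_family1 p D (g : 'I_D -> T * 'I_p) :
  injective g -> block_family g g (fun=> 1%:M) = 1%:M.
Proof.
move=> g_inj; apply/matrixP => i j; rewrite !mxE -(inj_eq g_inj).
by case: (g i) (g j) => t x [t' x'] /=; rewrite xpair_eqE; case: eqP.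
Qed.

Lemma block_familyB p q D E (g : 'I_D -> T * 'I_p) (h : 'I_E -> T * 'I_q)
    (B B' : T -> 'M[K]_(p, q)) :
  block_family g h B - block_family g h B' =
  block_family g h (fun t => B t - B' t).
Proof.
by apply/matrixP => i j; rewrite !mxE; case: ifP => // _; rewrite subr0.
Qed.

Lemma eq_block_family p q D E (g : 'I_D -> T * 'I_p) (h : 'I_E -> T * 'I_q)
    (B B' : T -> 'M[K]_(p, q)) :
  (forall t, B t = B' t) -> block_family g h B = block_family g h B'.
Proof. by move=> eqB; apply/matrixP => i j; rewrite !mxE eqB. Qed.

(** The blocks of the inverse with equal row and column group invert the
    blocks of B, because B does not mix groups. *)
Lemma block_family_unit p D (g : 'I_D -> T * 'I_p) (B : T -> 'M[K]_p) :
  bijective g -> block_family g g B \in unitmx -> forall t, B t \in unitmx.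
Proof.
case=> g' g'K gK uB t.
pose X t : 'M[K]_p :=
  \matrix_(x, y) invmx (block_family g g B) (g' (t, x)) (g' (t, y)).
suff BX : B t *m X t = 1%:M by case/mulmx1_unit: BX.
have /matrixP BX := mulmxV uB; apply/matrixP => x y.
have := BX (g' (t, x)) (g' (t, y)); rewrite !mxE => BXxy.
rewrite (inj_eq (can_inj gK)) xpair_eqE eqxx /= in BXxy.
rewrite -{}BXxy (reindex g'); last by apply: onW_bij; exists g.
pose F s z := (if t == s then B t x z else 0) *
   invmx (block_family g g B) (g' (s, z)) (g' (t, y)).
rewrite [RHS](eq_bigr (fun sz => F sz.1 sz.2)) => [|[s z] _]; last first.
  by rewrite mxE !gK.
rewrite -(pair_bigA _ F) /F /=.
rewrite (bigD1 t) //= [X in _ + X]big1 => [|s st]; last first.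
  by apply: big1 => z _; rewrite eq_sym (negPf st) mul0r.
by rewrite addr0 eqxx; apply: eq_bigr => z _; rewrite mxE.
Qed.

Lemma block_familyV p D (g : 'I_D -> T * 'I_p) (B : T -> 'M[K]_p) :
  bijective g -> block_family g g B \in unitmx ->
  invmx (block_family g g B) = block_family g g (fun t => invmx (B t)).
Proof.
move=> g_bij uB; rewrite -[RHS](mulKmx uB) block_familyM //.
suff -> : block_family g g (fun t => B t *m invmx (B t)) = 1%:M.
  by rewrite mulmx1.
rewrite -(block_family1 (bij_inj g_bij)); apply: eq_block_family => t.
by rewrite mulmxV //; exact: block_family_unit uB _.
Qed.

(** Identity blocks between two groupings of the same indices match each index
    with the one that has the same coordinates; changing the order of the
    indices is thus multiplication by one more block family. *)
Lemma perm_block_family p D (g h : 'I_D -> T * 'I_p) :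
  bijective g -> bijective h ->
  exists s : 'S_D, perm_mx s = block_family g h (fun=> 1%:M).
Proof.
move=> g_bij [h' hK h'K].
have f_inj : injective (h' \o g).
  by apply: inj_comp; [exact: can_inj h'K | exact: bij_inj].
exists (perm f_inj); apply/matrixP => i j; rewrite !mxE permE /=.
rewrite -(inj_eq (can_inj hK)) h'K.
by case: (g i) (h j) => t x [t' x'] /=; rewrite xpair_eqE; case: eqP.
Qed.

End BlockFamily.

(** * Roots of unity and Fourier matrices *)

Section Roots.
Variable R : realType.

Lemma expiD (a b : R) : expi (a + b) = expi a * expi b.
Proof. by rewrite /expi cosD sinD; simpc; congr (_ +i* _); rewrite addrC. Qed.

Lemma conjcM (x y : R[i]) : conjc (x * y) = conjc x * conjc y.
Proof. exact: (rmorphM (@conjc R)). Qed.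

Lemma expi0 : expi (0 : R) = 1.
Proof. by rewrite /expi cos0 sin0. Qed.

Lemma expiMn (a : R) k : expi (a * k%:R) = expi a ^+ k.
Proof.
elim: k => [|k IH]; first by rewrite mulr0 expi0.
by rewrite -natr1 mulrDr mulr1 expiD IH exprSr.
Qed.

Lemma conj_expi (a : R) : (expi a)^* = expi (- a).
Proof. by rewrite /expi cosN sinN. Qed.

Lemma expiN (a : R) : expi (- a) = (expi a)^-1.
Proof.
have e : expi (- a) * expi a = 1 by rewrite -expiD addNr expi0.
by rewrite -(mulr1_eq e) invrK.
Qed.

Lemma expi_neq0 (a : R) : expi a != 0.
Proof.
apply/eqP => a0; have := expiD a (- a).
by rewrite subrr expi0 a0 mul0r => /eqP; rewrite oner_eq0.
Qed.

Definition omega (N : nat) : R[i] := expi (2 * pi / N%:R).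

Lemma omega_primitive N : (0 < N)%N -> N.-primitive_root (omega N).
Proof.
move=> N0; have N0' : 0 < N%:R :> R by rewrite ltr0n.
have ox k : omega N ^+ k = expi (2 * pi / N%:R * k%:R) by rewrite expiMn.
apply/andP; split => //; apply/forallP => i; rewrite unity_rootE ox; apply/eqP.
case: (eqVneq i.+1 N) => [->|iN].
  rewrite divfK ?lt0r_neq0 //; apply/eqP.
  by rewrite mulrC mulr_natr /expi cos2pi sin2pi.
apply/negP => /eqP [] + _; apply/eqP.
have iN' : (i.+1 < N)%N by rewrite ltn_neqAle iN ltn_ord.
rewrite lt_eqF //; set t := (X in cos X).
have th : t / 2 = pi * (i.+1%:R / N%:R).
  by rewrite /t; field; rewrite lt0r_neq0.
have : 0 < sin (t / 2).
  rewrite sin_gt0_pi // th pmulr_rgt0 ?pi_gt0 // divr_gt0 ?ltr0n //=.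
  by rewrite gtr_pMr ?pi_gt0 // ltr_pdivrMr // mul1r ltr_nat.
(* cos t = 1 - 2 (sin (t / 2))^2 and 0 < t / 2 < pi *)
move=> s0; rewrite (_ : t = t / 2 *+ 2) ?mulr_natr -?splitr; last first.
  by rewrite -mulr_natr divfK ?pnatr_eq0.
rewrite cos_mulr2n cos2sin2; nra.
Qed.

(** The summands are the powers of omega^b / omega^a, an N-th root of unity
    which is 1 exactly when a = b modulo N: otherwise the geometric sum
    vanishes. *)
Lemma omega_orthogonal N (a b : nat) : (0 < N)%N ->
  \sum_(i < N) conjc (omega N ^+ (a * i)) * omega N ^+ (b * i) =
  if a == b %[mod N] then N%:R else 0.
Proof.
move=> N0; have o_prim := omega_primitive N0.
have o0 : omega N != 0 by exact: expi_neq0.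
pose z := omega N ^+ b / omega N ^+ a.
have -> : \sum_(i < N) conjc (omega N ^+ (a * i)) * omega N ^+ (b * i) =
    \sum_(i < N) z ^+ i.
  apply: eq_bigr => i _.
  rewrite -[omega N ^+ (a * i)]expiMn conj_expi expiN expiMn -/(omega N).
  by rewrite /z expr_div_n -!exprM mulrC.
have zE : (z == 1) = (a == b %[mod N]).
  rewrite -(eq_prim_root_expr o_prim) [RHS]eq_sym /z.
  have oa : omega N ^+ a != 0 by rewrite expf_neq0.
  by rewrite -(inj_eq (mulIf oa)) divfK // mul1r.
rewrite -zE; case: eqVneq => [-> | z1].
  by under eq_bigr do rewrite expr1n; rewrite sumr_const card_ord.
have : z ^+ N - 1 = 0.
  rewrite /z expr_div_n -!exprM ![(_ * N)%N]mulnC !exprM.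
  by rewrite (prim_expr_order o_prim) !expr1n divr1 subrr.
by rewrite subrX1 => /eqP; rewrite mulf_eq0 subr_eq0 (negPf z1) => /eqP.
Qed.

Lemma fourier_mxE N (j k : 'I_N) :
  fourier_mx R N j k = ((Num.sqrt (N%:R : R))^-1)%:C * omega N ^+ (k * j).
Proof. by rewrite mxE -mulrA -natrM expiMn. Qed.

Lemma fourier_unitary N : adjoint_mx (fourier_mx R N) *m fourier_mx R N = 1%:M.
Proof.
case: N => [|N]; first by apply/matrixP => -[].
apply/matrixP => i j; rewrite mxE.
under eq_bigr => k _.
  rewrite [adjoint_mx _ _ _]mxE [X in conjc X]mxE !fourier_mxE.
  rewrite conjcM conjc_real mulrACA; over.
rewrite -mulr_sumr omega_orthogonal // !modn_small // mxE -val_eqE.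
case: eqP => _; last by rewrite mulr0.
rewrite -rmorphM /= -invfM -expr2 sqr_sqrtr ?ler0n //.
by rewrite -(rmorph_nat (real_complex R)) -rmorphM /= mulVf ?pnatr_eq0.
Qed.

Lemma fourier_adjoint N : fourier_mx R N *m adjoint_mx (fourier_mx R N) = 1%:M.
Proof. exact: mulmx1C (fourier_unitary N). Qed.

Lemma fourier_unit N : fourier_mx R N \in unitmx.
Proof. by case/mulmx1_unit: (fourier_unitary N). Qed.

End Roots.

(** * Circulant matrices in the Fourier basis *)

Section Circulant.
Variable R : realType.

Lemma modn_sub_add N (i j : 'I_N) : (i + N - j) %% N + j = i %[mod N].
Proof.
by rewrite modnDml subnK ?modnDr // (leq_trans (ltnW (ltn_ord j))) ?leq_addl.
Qed.

Lemma conj_omegaX_mul N m : conjc (omega R N ^+ m) * omega R N ^+ m = 1.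
Proof. by rewrite -expiMn conj_expi -expiD addNr expi0. Qed.

Definition circulant_eig (N : nat) (c : nat -> R) (k : 'I_N) : R[i] :=
  \sum_(t < N) (c t)%:C * conjc (omega R N ^+ (k * t)).

(** The sum over j of c (i - j) omega^(k j) becomes, with t = i - j, the sum of
    c t omega^(- k t) times omega^(k i). *)
Lemma circulant_fourier N (c : nat -> R) (C : 'M[R]_N) :
  (forall i j : 'I_N, C i j = c ((i + N - j) %% N)%N) ->
  toC C *m fourier_mx R N =
  fourier_mx R N *m diag_mx (\row_k circulant_eig c k).
Proof.
case: N C => [|N] C; first by move=> _; apply/matrixP => -[].
move=> cC; apply/matrixP => i k.
rewrite mul_mx_diag [LHS]mxE [RHS]mxE [X in _ * X]mxE.
have o_prim := @omega_primitive R N.+1 isT.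
(* h j = i - j modulo N.+1, an involution of the summation indices *)
pose h (j : 'I_N.+1) := Ordinal (ltn_pmod (i + N.+1 - j) (ltn0Sn N)).
have hj (j : 'I_N.+1) : (h j + j = i %[mod N.+1])%N by exact: modn_sub_add.
have hK : involutive h.
  move=> j; have : (h (h j) = j %[mod N.+1])%N.
    by apply/eqP; rewrite -(eqn_modDr (h j)) hj [(j + _)%N]addnC hj.
  rewrite (modn_small (ltn_ord (h (h j)))) (modn_small (ltn_ord j)).
  exact: val_inj.
rewrite (reindex_inj (inv_inj hK)) /circulant_eig big_distrr /=.
apply: eq_bigr => j _; rewrite !fourier_mxE mxE cC.
rewrite -[X in c X]/(h (h j) : nat) hK.
rewrite -mulrA mulrCA; congr (_ * _); rewrite mulrCA; congr (_ * _).
have -> : omega R N.+1 ^+ (k * i) =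
    omega R N.+1 ^+ (k * h j) * omega R N.+1 ^+ (k * j).
  apply/eqP; rewrite -exprD -mulnDr (eq_prim_root_expr o_prim).
  by rewrite -[(k * i %% _)%N]modnMmr -(hj j) modnMmr.
by rewrite -mulrA [_ * conjc _]mulrC conj_omegaX_mul mulr1.
Qed.

(** Reducing 1 modulo L makes this hold for L = 1 as well, where the shift is
    the identity. *)
Lemma cyclic_shift_circulant L (i j : 'I_L) : (0 < L)%N ->
  cyclic_shift_mx L i j = (((i + L - j) %% L)%N == (1 %% L)%N)%:R :> R.
Proof.
move=> L0; rewrite mxE; congr (_%:R); congr nat_of_bool.
rewrite -[in RHS](modn_mod (i + L - j)%N) -[RHS](eqn_modDr j).
rewrite modn_sub_add add1n.
rewrite (modn_small (ltn_ord i)).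
have := ltn_ord j; rewrite leq_eqVlt => /orP[/eqP jL|jL].
  by rewrite jL modnn eqxx andbT [(i == L :> nat)]ltn_eqF.
by rewrite (ltn_eqF jL) andbF orbF modn_small.
Qed.

Lemma cyclic_shift_fourier L : (0 < L)%N ->
  toC (cyclic_shift_mx L) *m fourier_mx R L =
  fourier_mx R L *m diag_mx (\row_j expi (- (2 * pi * (j%:R / L%:R)))).
Proof.
move=> L0; rewrite (circulant_fourier (c := fun t => ((t == 1 %% L)%N)%:R)).
  2: by move=> i j; exact: cyclic_shift_circulant.
congr (_ *m diag_mx _); apply/rowP => j; rewrite !mxE /circulant_eig.
pose t1 := Ordinal (ltn_pmod 1 L0).
rewrite (bigD1 t1) //= eqxx mul1r [X in _ + X]big1 => [|t tt1]; last first.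
  rewrite (_ : (t == 1 %% L :> nat)%N = false) ?mul0r //.
  by apply/negbTE; apply: contraNneq tt1 => tE; apply/eqP/val_inj.
rewrite addr0 -[expi _]mulr1 -(conj_omegaX_mul L j) mulrCA.
rewrite (_ : expi _ * omega R L ^+ j = 1) ?mulr1; last first.
  rewrite -expiMn -expiD -expi0; congr expi.
  by rewrite -!mulrA [L%:R^-1 * _]mulrC addNr.
congr conjc; apply/eqP; rewrite (eq_prim_root_expr (omega_primitive R L0)).
by rewrite modnMmr muln1.
Qed.

End Circulant.

(** * Symbols of the interweaved transfer operators *)

Section Symbols.
Variable R : realType.

Lemma mulmx_interweave n (X Y Z : 'M[R[i]]_n) :
  interweave X Y *m Z = interweave (X *m Z) (Y *m Z).
Proof.
apply/matrixP => i j; rewrite !mxE.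
under eq_bigr do rewrite mxE.
by case: ifP => _; apply: eq_bigr.
Qed.

Lemma toC_interweave n (X Y : 'M[R]_n) :
  toC (interweave X Y) = interweave (toC X) (toC Y).
Proof. by apply/matrixP => i j; rewrite !mxE; case: ifP. Qed.

Lemma sum_even_odd (V : nmodType) n (F : nat -> V) :
  \sum_(j < n + n) F j = \sum_(i < n) (F i.*2 + F i.*2.+1).
Proof.
rewrite addnn; elim: n => [|n IH]; first by rewrite !big_ord0.
by rewrite doubleS !big_ord_recr /= IH addrA.
Qed.

Lemma omega_squareX n k : (0 < n)%N ->
  omega R (n + n) ^+ (k * 2) = omega R n ^+ k.
Proof.
move=> n0; rewrite -!expiMn natrM natrD; congr expi.
have n0' : n%:R != 0 :> R by rewrite pnatr_eq0 -lt0n.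
by field; rewrite n0' -mulr2n mulrn_eq0.
Qed.

(** Aliasing. Split the fine grid into even and odd points. On the even points
    the fine exponential of frequency k' restricts to the coarse one, on the
    odd points it carries the extra phase omega^k', while the interpolated
    coarse exponential equals itself, respectively itself times an eigenvalue
    of C. Both halves are multiples of the same coarse inner product. *)
Lemma interp_symbol_eq0 n (S : 'M[R]_(n + n, n)) (k' : 'I_(n + n)) (k : 'I_n) :
  CI_interpolation S -> (k' != k %[mod n])%N -> interp_symbol S k' k = 0.
Proof.
case=> C [[c cC] _ ->] k'k.
have n0 : (0 < n)%N by exact: leq_ltn_trans (leq0n k) (ltn_ord k).
rewrite /interp_symbol -mulmxA toC_interweave mulmx_interweave.
rewrite (circulant_fourier cC) /toC map_mx1 mul1mx mxE.
pose s (N : nat) : R[i] := ((Num.sqrt (N%:R : R))^-1)%:C.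
pose a (i : nat) : R[i] := s n * omega R n ^+ (k * i).
pose F (j : nat) : R[i] := conjc (s (n + n)%N * omega R (n + n) ^+ (k' * j)) *
   (if odd j then a j./2 * circulant_eig c k else a j./2).
rewrite (eq_bigr (fun j : 'I_(n + n) => F j)); last first.
  move=> j _; rewrite [adjoint_mx _ _ _]mxE [X in conjc X]mxE fourier_mxE.
  rewrite mxE mul_mx_diag [X in if _ then X else _]mxE fourier_mxE.
  by rewrite [X in if _ then _ * X else _]mxE.
rewrite sum_even_odd.
pose b := conjc (s (n + n)%N) * s n *
  (1 + conjc (omega R (n + n) ^+ k') * circulant_eig c k).
rewrite (eq_bigr (fun i : 'I_n =>
  b * (conjc (omega R n ^+ (k' * i)) * omega R n ^+ (k * i)))).
  by rewrite -mulr_sumr omega_orthogonal // (negPf k'k) mulr0.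
move=> i _; rewrite /F odd_double /= odd_double /= uphalf_double doubleK.
rewrite -[i.*2.+1]addn1 mulnDr muln1 -muln2 mulnA exprD.
rewrite omega_squareX // /a /b !conjcM.
by rewrite -!mulrA; ring.
Qed.

(** Row k' < n and row n + k' both have the residue k' modulo n, whence one
    diagonal block for each half of the rows. *)
Lemma interp_symbolE n (S : 'M[R]_(n + n, n)) : CI_interpolation S ->
  interp_symbol S = col_mx (diag_mx (\row_k interp_d S k))
                           (diag_mx (\row_k interp_dhat S k)).
Proof.
move=> S_CI; have Z0 k' k := @interp_symbol_eq0 n S k' k S_CI.
rewrite /interp_d /interp_dhat; move: (interp_symbol S) Z0 => Z Z0.
apply/matrixP => i k.
case: (split_ordP i) => k' ->; rewrite ?col_mxEu ?col_mxEd !mxE.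
  case: eqVneq => [->|k'k]; first by rewrite mulr1n.
  by rewrite mulr0n Z0 //= !modn_small.
case: eqVneq => [->|k'k]; first by rewrite mulr1n.
by rewrite mulr0n Z0 //= modnDl !modn_small.
Qed.

Lemma restr_symbol_adjoint n (W : 'M[R]_(n + n, n)) :
  restr_symbol W^T = adjoint_mx (interp_symbol W).
Proof.
rewrite /restr_symbol /interp_symbol /adjoint_mx /toC !trmx_mul.
have conjM m p q (X : 'M[R[i]]_(m, p)) (Y : 'M[R[i]]_(p, q)) :
    map_mx (@conjc R) (X *m Y) = map_mx (@conjc R) X *m map_mx (@conjc R) Y.
  exact: (map_mxM (@conjc R)).
rewrite !conjM mulmxA; congr (_ *m _ *m _); apply/matrixP => i j; rewrite !mxE.
  by rewrite conjc_real.
by rewrite conjcK.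
Qed.

Lemma restr_symbolE n (Rst : 'M[R]_(n, n + n)) : CI_restriction Rst ->
  restr_symbol Rst = row_mx (diag_mx (\row_k restr_f Rst k))
                           (diag_mx (\row_k restr_fhat Rst k)).
Proof.
case=> c W_CI; set W := c *: _ in W_CI.
have sym0 (k : 'I_n) (k' : 'I_(n + n)) :
    (k' != k %[mod n])%N -> restr_symbol Rst k k' = 0.
  move=> k'k; have n0 : (0 < n)%N by exact: leq_ltn_trans (leq0n k) (ltn_ord k).
  (* the entry (0, 0) of an interpolation is 1, so it is not a zero multiple *)
  have c0 : c != 0.
    have [C [_ _]] := W_CI; rewrite /W => /matrixP.
    have n0' : (0 < n + n)%N by rewrite addn_gt0 n0.
    move=> /(_ (Ordinal n0') (Ordinal n0)); rewrite !mxE /= => Wc.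
    apply: contra_eq_neq Wc => ->.
    by rewrite mul0r eq_sym oner_eq0.
  have : c%:C *: restr_symbol Rst = adjoint_mx (interp_symbol W).
    rewrite -restr_symbol_adjoint /W [in RHS]linearZ /= trmxK /restr_symbol.
    by rewrite /toC map_mxZ -scalemxAr -scalemxAl.
  move=> /matrixP /(_ k k'); rewrite mxE [in RHS]mxE [X in conjc X]mxE.
  rewrite interp_symbol_eq0 // conjc0 => /eqP; rewrite mulf_eq0 => /orP[|/eqP//].
  by rewrite fmorph_eq0 (negPf c0).
rewrite /restr_f /restr_fhat; move: (restr_symbol Rst) sym0 => Z Z0.
apply/matrixP => k i.
case: (split_ordP i) => k' ->; rewrite ?row_mxEl ?row_mxEr !mxE.
  case: eqVneq => [->|kk']; first by rewrite mulr1n.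
  by rewrite mulr0n Z0 //= !modn_small // eq_sym.
case: eqVneq => [->|kk']; first by rewrite mulr1n.
by rewrite mulr0n Z0 //= modnDl !modn_small // eq_sym.
Qed.

End Symbols.

(** * Index orderings and the transformed composite operators *)

Section Layers.
Variable R : realType.
Implicit Types (L M N n : nat).

(** Group (frequency, j), position the quadrature node; the frequency comes
    first because it is the slow index in diag_blocks. *)
Definition layer_coord L M N (i : 'I_(L * M * N)) : ('I_N * 'I_L) * 'I_M :=
  let u := mxtens_unindex i in
  let v := mxtens_unindex u.1 in
  ((u.2, v.1), v.2).

Lemma layer_coord_inj L M N : injective (@layer_coord L M N).
Proof.
move=> i j [] ek el em; apply: (can_inj (@mxtens_unindexK _ _)).
apply/eqP; rewrite xpair_eqE; apply/andP; split; last exact/eqP/val_inj.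
apply/eqP/(can_inj (@mxtens_unindexK _ _)).
by apply/eqP; rewrite xpair_eqE; apply/andP; split; apply/eqP/val_inj.
Qed.

Lemma layer_coord_bij L M N : bijective (@layer_coord L M N).
Proof.
apply: inj_card_bij; first exact: layer_coord_inj.
by rewrite !card_prod !card_ord -mulnA mulnC.
Qed.

(** The harmonics k and n + k, which coincide on the coarse grid, share the
    group of k; they fill the first and the second half of its positions. *)
Definition pair_coord L M n (i : 'I_(L * M * (n + n))) :
    ('I_n * 'I_L) * 'I_(M + M) :=
  let: ((k, l), m) := layer_coord i in
  match fintype.split k with
  | inl k0 => ((k0, l), lshift M m)
  | inr k1 => ((k1, l), rshift M m)
  end.

Lemma pair_coord_inj L M n : injective (@pair_coord L M n).
Proof.
move=> i j ij; apply: layer_coord_inj; move: ij; rewrite /pair_coord.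
case: (layer_coord i) (layer_coord j) => [[k l] m] [[k' l'] m'].
case: (split_ordP k) => a ->; case: (split_ordP k') => b ->;
  move=> /eqP; rewrite !xpair_eqE => /andP[/andP[/eqP-> /eqP->]];
  rewrite ?eq_lshift ?eq_rshift ?eq_lrshift ?eq_rlshift // => /eqP-> //.
Qed.

Lemma pair_coord_bij L M n : bijective (@pair_coord L M n).
Proof.
apply: inj_card_bij; first exact: pair_coord_inj.
by rewrite !card_prod !card_ord !mulnDr -mulnA mulnC.
Qed.

Definition diag_coord K L m D (e : (\sum_(i < K * L) m)%N = D) (i : 'I_D) :
    ('I_K * 'I_L) * 'I_m :=
  let i' := cast_ord (esym e) i in
  (mxtens_unindex (tagnat.sig1 i'), tagnat.sig2 i').

Lemma diag_coord_inj K L m D (e : (\sum_(i < K * L) m)%N = D) :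
  injective (diag_coord e).
Proof.
move=> i j; rewrite /diag_coord => -[].
move=> e1 e2 e3; apply: (@cast_ord_inj _ _ (esym e)).
rewrite -[LHS]tagnat.sig2K -[RHS]tagnat.sig2K.
have : tagnat.sig1 (cast_ord (esym e) i) = tagnat.sig1 (cast_ord (esym e) j).
  apply: (can_inj (@mxtens_unindexK _ _)).
  by apply/eqP; rewrite xpair_eqE; apply/andP; split; apply/eqP/val_inj.
rewrite /tagnat.Rank; move: (tagnat.sig2 _) (tagnat.sig2 _) e3 => a b.
by move: (tagnat.sig1 _) (tagnat.sig1 _) a b => s t a b /= -> ->.
Qed.

Lemma diag_coord_bij K L m D (e : (\sum_(i < K * L) m)%N = D) :
  bijective (diag_coord e).
Proof.
apply: inj_card_bij; first exact: diag_coord_inj.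
by rewrite !card_prod !card_ord -e sum_nat_const card_ord.
Qed.

Lemma diag_blocksE K L m D (e : (\sum_(i < K * L) m)%N = D)
    (B : 'I_K -> 'I_L -> 'M[R[i]]_m) :
  diag_blocks e B =
  block_family (diag_coord e) (diag_coord e) (fun t => B t.1 t.2).
Proof.
apply/matrixP => i j; rewrite castmxE !mxE.
rewrite (can_eq (@mxtens_unindexK _ _)).
by case: ifP => _; rewrite ?conform_mx_id // mxE.
Qed.

Lemma pair_block_family L M n (B : 'I_(n + n) -> 'I_L -> 'M[R[i]]_M) :
  block_family (@layer_coord L M (n + n)) (@layer_coord L M (n + n))
    (fun t => B t.1 t.2) =
  block_family (@pair_coord L M n) (@pair_coord L M n)
    (fun t => block_mx (B (lshift n t.1) t.2) 0 0 (B (rshift n t.1) t.2)).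
Proof.
apply/matrixP => i j; rewrite [LHS]mxE [RHS]mxE /pair_coord.
case: (layer_coord i) (layer_coord j) => [[k l] m] [[k' l'] m'] /=.
rewrite !xpair_eqE.
case: (split_ordP k) => a ->; case: (split_ordP k') => b -> /=;
  rewrite ?eq_lshift ?eq_rshift ?eq_lrshift ?eq_rlshift
    ?block_mxEul ?block_mxEur ?block_mxEdl ?block_mxEdr ?mxE xpair_eqE /=;
  by case: ifP.
Qed.

Lemma interp_block_family L M n (d dh : 'rV[R[i]]_n) :
  (1%:M : 'M[R[i]]_L) *t (1%:M : 'M[R[i]]_M) *t col_mx (diag_mx d) (diag_mx dh) =
  block_family (@pair_coord L M n) (@layer_coord L M n)
    (fun t => col_mx (d 0 t.1)%:M (dh 0 t.1)%:M).
Proof.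
apply/matrixP => i j.
rewrite [LHS]mxE [RHS]mxE [X in X * _]mxE /pair_coord /layer_coord.
move: (mxtens_unindex i) (mxtens_unindex j) => [u k] [v k'] /=.
by case: (split_ordP k) => a -> /=;
  rewrite ?col_mxEu ?col_mxEd !mxE xpair_eqE;
  do !case: (_ == _) => /=;
  rewrite ?(mulr1n, mulr0n, mulr1, mulr0, mul1r, mul0r).
Qed.

Lemma restr_block_family L M n (f fh : 'rV[R[i]]_n) :
  (1%:M : 'M[R[i]]_L) *t (1%:M : 'M[R[i]]_M) *t row_mx (diag_mx f) (diag_mx fh) =
  block_family (@layer_coord L M n) (@pair_coord L M n)
    (fun t => row_mx (f 0 t.1)%:M (fh 0 t.1)%:M).
Proof.
apply/matrixP => i j.
rewrite [LHS]mxE [RHS]mxE [X in X * _]mxE /pair_coord /layer_coord.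
move: (mxtens_unindex i) (mxtens_unindex j) => [u k] [v k'] /=.
by case: (split_ordP k') => a -> /=;
  rewrite ?row_mxEl ?row_mxEr !mxE xpair_eqE;
  do !case: (_ == _) => /=;
  rewrite ?(mulr1n, mulr0n, mulr1, mulr0, mul1r, mul0r).
Qed.

Lemma eigencolumns_diag N (a : 'M[R[i]]_N) (F : 'M[R[i]]_N) (lam : 'I_N -> R[i]) :
  (forall k, a *m col k F = lam k *: col k F) ->
  a *m F = F *m diag_mx (\row_k lam k).
Proof.
move=> aF; apply/matrixP => i k; have /matrixP/(_ i 0) := aF k.
rewrite mul_mx_diag !mxE => aFik; rewrite mulrC -aFik.
by apply: eq_bigr => j _; rewrite mxE.
Qed.

Lemma fourier_layers_unit L M N : fourier_layers R L M N \in unitmx.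
Proof.
have : (invmx (fourier_mx R L) *t (1%:M : 'M[R[i]]_M)
    *t invmx (fourier_mx R N)) *m fourier_layers R L M N = 1%:M.
  rewrite !tensmx_mul mul1mx !mulVmx ?fourier_unit //.
  apply/matrixP => i j; rewrite !mxE -!natrM !mulnb; congr (_%:R).
  rewrite -(can_eq (@mxtens_unindexK _ _) i) xpair_eqE.
  by rewrite -(can_eq (@mxtens_unindexK _ _) (mxtens_unindex i).1) xpair_eqE.
by case/mulmx1_unit.
Qed.

(** Moving the Fourier factors through each Kronecker product replaces a and
    the cyclic shift by diagonal matrices; the entries at fixed frequency and
    fixed j are then those of the time block. *)
Lemma composite_fourier L M N (dt : R) (q : 'M[R]_M) (a : 'M[R]_N)
    (lam : 'I_N -> R[i]) : (0 < L)%N ->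
  (forall k, toC a *m col k (fourier_mx R N)
             = lam k *: col k (fourier_mx R N)) ->
  toC (composite_mx L dt q a) *m fourier_layers R L M N =
  fourier_layers R L M N *m
    block_family (@layer_coord L M N) (@layer_coord L M N)
      (fun t => time_block dt q (lam t.1) t.2).
Proof.
move=> L0 /eigencolumns_diag aF.
have toC_last : toC (last_col_mx M : 'M[R]_M) = last_col_mx M.
  by apply/matrixP => i j; rewrite !mxE rmorph_nat.
have cF := cyclic_shift_fourier R L0; set e := diag_mx _ in cF.
have -> : block_family (@layer_coord L M N) (@layer_coord L M N)
      (fun t => time_block dt q (lam t.1) t.2) =
    (1%:M : 'M[R[i]]_L) *t (1%:M : 'M[R[i]]_M) *t (1%:M : 'M[R[i]]_N)
    - dt%:C *: ((1%:M : 'M[R[i]]_L) *t toC q *t diag_mx (\row_k lam k))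
    - e *t last_col_mx M *t (1%:M : 'M[R[i]]_N).
  apply/matrixP => i j; rewrite !mxE /layer_coord.
  move: (mxtens_unindex i) (mxtens_unindex j) => [u k] [v k'] /=.
  rewrite xpair_eqE.
  do 2!case: (_ == _) => /=;
  rewrite ?(mulr1n, mulr0n, mulr1, mulr0, mul1r, mul0r, subr0, add0r, oppr0) //.
  by rewrite mulrA; congr (_ - _ - _); ring.
rewrite /composite_mx /toC !map_mxB map_mxZ !map_mxT !map_mx1.
rewrite -!/(toC _) toC_last !mulmxBl !mulmxBr -scalemxAl -scalemxAr.
by rewrite /fourier_layers !tensmx_mul !mul1mx !mulmx1 aF cF.
Qed.

End Layers.

(** * The iteration matrix *)

Section Iteration.
Variable R : realType.

Lemma intertwine_inv D (X Y F : 'M[R[i]]_D) :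
  F \in unitmx -> X \in unitmx -> X *m F = F *m Y ->
  Y \in unitmx /\ invmx X *m F = F *m invmx Y.
Proof.
move=> uF uX XF.
have uY : Y \in unitmx.
  by rewrite -[Y](mulKmx uF) -XF !unitmx_mul unitmx_inv uF uX.
by split=> //; rewrite -[LHS](mulmxK uY) -[invmx X *m F *m Y]mulmxA -XF mulKmx.
Qed.

Lemma intertwine_transforms_into D (F X Y : 'M[R[i]]_D) :
  F \in unitmx -> X *m F = F *m Y -> transforms_into F X Y.
Proof. by move=> uF XF; split=> //; rewrite -mulmxA XF mulKmx. Qed.

(** Taking the permutation as an argument allows the same one to serve for
    several matrices X. *)
Lemma transforms_into_reindex (T : finType) p D (g h : 'I_D -> T * 'I_p)
    (F X : 'M[R[i]]_D) (B : T -> 'M[R[i]]_p) (s : 'S_D) :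
  bijective g -> bijective h ->
  perm_mx s = block_family (K := R[i]) g h (fun=> 1%:M) ->
  F \in unitmx -> X *m F = F *m block_family g g B ->
  transforms_into (F *m perm_mx s) X (block_family h h B).
Proof.
move=> g_bij h_bij sE uF XF; apply: intertwine_transforms_into.
  by rewrite unitmx_mul uF unitmx_perm.
rewrite mulmxA XF -!mulmxA sE !block_familyM //; congr (_ *m _).
by apply: eq_block_family => t; rewrite mulmx1 mul1mx.
Qed.

Lemma interp_transfer_fourier L M n (S : 'M[R]_(n + n, n)) :
  CI_interpolation S ->
  toC (space_transfer L M S) *m fourier_layers R L M n =
  fourier_layers R L M (n + n) *m
    block_family (@pair_coord L M n) (@layer_coord L M n)
      (fun t => col_mx (interp_d S t.1)%:M (interp_dhat S t.1)%:M).
Proof.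
move=> S_CI.
have -> : block_family (@pair_coord L M n) (@layer_coord L M n)
      (fun t => col_mx (interp_d S t.1)%:M (interp_dhat S t.1)%:M) =
    (1%:M : 'M[R[i]]_L) *t (1%:M : 'M[R[i]]_M) *t interp_symbol S.
  rewrite interp_symbolE // interp_block_family.
  by apply: eq_block_family => t; rewrite !mxE.
rewrite /toC /space_transfer !map_mxT !map_mx1 /fourier_layers !tensmx_mul.
by rewrite !mul1mx !mulmx1 /interp_symbol !mulmxA fourier_adjoint mul1mx.
Qed.

Lemma restr_transfer_fourier L M n (Rst : 'M[R]_(n, n + n)) :
  CI_restriction Rst ->
  toC (space_transfer L M Rst) *m fourier_layers R L M (n + n) =
  fourier_layers R L M n *m
    block_family (@layer_coord L M n) (@pair_coord L M n)
      (fun t => row_mx (restr_f Rst t.1)%:M (restr_fhat Rst t.1)%:M).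
Proof.
move=> Rst_CI.
have -> : block_family (@layer_coord L M n) (@pair_coord L M n)
      (fun t => row_mx (restr_f Rst t.1)%:M (restr_fhat Rst t.1)%:M) =
    (1%:M : 'M[R[i]]_L) *t (1%:M : 'M[R[i]]_M) *t restr_symbol Rst.
  rewrite restr_symbolE // restr_block_family.
  by apply: eq_block_family => t; rewrite !mxE.
rewrite /toC /space_transfer !map_mxT !map_mx1 /fourier_layers !tensmx_mul.
by rewrite !mul1mx !mulmx1 /restr_symbol !mulmxA fourier_adjoint mul1mx.
Qed.

(** One group of the two-grid iteration: the column (d, dhat) and the row
    (f, fhat) are the transfers between the coarse frequency and its two
    harmonics. *)
Lemma two_grid_blockE M (d dh f fh : R[i])
    (BP0 BM0 BP1 BM1 BPt : 'M[R[i]]_M) :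
  block_mx BP0 0 0 BP1 \in unitmx ->
  (1%:M - invmx (block_mx BP0 0 0 BP1) *m block_mx BM0 0 0 BM1) *m
  (1%:M - col_mx d%:M dh%:M *m invmx BPt *m row_mx f%:M fh%:M
            *m block_mx BM0 0 0 BM1) =
  smoother_block BP0 BM0 BP1 BM1 *m cgc_block d dh f fh BPt BM0 BM1.
Proof.
move=> uBP; congr (_ *m _).
  rewrite invmx_block_diag // mulmx_block !mul0mx !mulmx0 !addr0 !add0r.
  by rewrite (@scalar_mx_block _ M M 1) opp_block_mx add_block_mx oppr0 addr0.
rewrite -!mulmxA mul_row_block !mulmx0 addr0 add0r mul_mx_row mul_col_row.
rewrite (@scalar_mx_block _ M M 1) opp_block_mx add_block_mx !add0r.
rewrite !mul_scalar_mx -!scalemxAr !scalerA.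
by rewrite [d * f]mulrC [d * fh]mulrC [dh * fh]mulrC.
Qed.

Lemma toC_two_grid D d (X Y : 'M[R]_D) (Z : 'M[R]_d)
    (U : 'M[R]_(D, d)) (V : 'M[R]_(d, D)) :
  toC ((1%:M - invmx X *m Y) *m (1%:M - U *m invmx Z *m V *m Y)) =
  (1%:M - invmx (toC X) *m toC Y) *m
  (1%:M - toC U *m invmx (toC Z) *m toC V *m toC Y).
Proof.
by rewrite /toC map_mxM !map_mxB !map_mxM !map_mx1 !map_invmx.
Qed.

(** The factor F is pushed from right to left through the iteration, one
    operator at a time, passing to the coarse transformation Ft between the
    restriction and the interpolation. What it leaves behind are block
    families for compatible groupings. *)
Lemma iteration_fourier L M n (dt : R) (Q QD : 'M[R]_M)
    (A : 'M[R]_(n + n)) (At : 'M[R]_n)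
    (S : 'M[R]_(n + n, n)) (Rst : 'M[R]_(n, n + n))
    (BP BM : 'I_(n + n) -> 'I_L -> 'M[R[i]]_M)
    (BPt : 'I_n -> 'I_L -> 'M[R[i]]_M) :
  let F := fourier_layers R L M (n + n) in
  let Ft := fourier_layers R L M n in
  let g := @layer_coord L M (n + n) in
  let gt := @layer_coord L M n in
  CI_interpolation S -> CI_restriction Rst ->
  composite_mx L dt QD A \in unitmx -> composite_mx L dt QD At \in unitmx ->
  toC (composite_mx L dt QD A) *m F =
    F *m block_family g g (fun t => BP t.1 t.2) ->
  toC (composite_mx L dt Q A) *m F =
    F *m block_family g g (fun t => BM t.1 t.2) ->
  toC (composite_mx L dt QD At) *m Ft =
    Ft *m block_family gt gt (fun t => BPt t.1 t.2) ->
  toC (iteration_mx L dt Q QD A At S Rst) *m F =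
  F *m block_family (@pair_coord L M n) (@pair_coord L M n) (fun t =>
    smoother_block (BP (lshift n t.1) t.2) (BM (lshift n t.1) t.2)
                   (BP (rshift n t.1) t.2) (BM (rshift n t.1) t.2) *m
    cgc_block (interp_d S t.1) (interp_dhat S t.1)
              (restr_f Rst t.1) (restr_fhat Rst t.1) (BPt t.1 t.2)
              (BM (lshift n t.1) t.2) (BM (rshift n t.1) t.2)).
Proof.
move=> F Ft g gt S_CI Rst_CI P_inv Pt_inv PF MF PtF.
have uF : F \in unitmx by exact: fourier_layers_unit.
have uFt : Ft \in unitmx by exact: fourier_layers_unit.
have uP : toC (composite_mx L dt QD A) \in unitmx by rewrite map_unitmx.
have uPt : toC (composite_mx L dt QD At) \in unitmx by rewrite map_unitmx.
have [] := intertwine_inv uFt uPt PtF; rewrite /gt => uBt.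
rewrite (block_familyV (layer_coord_bij _ _ _) uBt) => VtF.
rewrite /g pair_block_family in PF; rewrite /g pair_block_family in MF.
have [uB] := intertwine_inv uF uP PF.
have g_bij := @pair_coord_bij L M n; have gt_bij := @layer_coord_bij L M n.
rewrite (block_familyV g_bij uB) => VF.
have SF := interp_transfer_fourier L M S_CI.
have RF := restr_transfer_fourier L M Rst_CI.
rewrite -/F -/Ft in SF RF.
have smoothF : (1%:M - invmx (toC (composite_mx L dt QD A))
      *m toC (composite_mx L dt Q A)) *m F =
    F *m block_family (@pair_coord L M n) (@pair_coord L M n) (fun t =>
      1%:M - invmx (block_mx (BP (lshift n t.1) t.2) 0
                           0 (BP (rshift n t.1) t.2))
        *m block_mx (BM (lshift n t.1) t.2) 0 0 (BM (rshift n t.1) t.2)).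
  rewrite mulmxBl mul1mx -mulmxA MF mulmxA VF -mulmxA.
  rewrite (block_familyM _ _ _ _ g_bij).
  by rewrite -block_familyB block_family1 ?mulmxBr ?mulmx1 //; exact: bij_inj.
have cgcF : (1%:M - toC (space_transfer L M S)
      *m invmx (toC (composite_mx L dt QD At)) *m toC (space_transfer L M Rst)
      *m toC (composite_mx L dt Q A)) *m F =
    F *m block_family (@pair_coord L M n) (@pair_coord L M n) (fun t =>
      1%:M - col_mx (interp_d S t.1)%:M (interp_dhat S t.1)%:M
        *m invmx (BPt t.1 t.2)
        *m row_mx (restr_f Rst t.1)%:M (restr_fhat Rst t.1)%:M
        *m block_mx (BM (lshift n t.1) t.2) 0 0 (BM (rshift n t.1) t.2)).
  rewrite -block_familyB block_family1; last exact: bij_inj.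
  rewrite mulmxBl mul1mx -[_ *m toC (composite_mx L dt Q A) *m F]mulmxA MF.
  rewrite mulmxA -[_ *m toC (space_transfer L M Rst) *m F]mulmxA RF.
  rewrite mulmxA -[_ *m invmx _ *m Ft]mulmxA VtF mulmxA SF.
  rewrite -!mulmxA !block_familyM // mulmxBr mulmx1; congr (_ - _ *m _).
  by apply: eq_block_family => t; rewrite !mulmxA.
rewrite /iteration_mx toC_two_grid.
rewrite -[_ *m _ *m F]mulmxA cgcF mulmxA smoothF -mulmxA.
rewrite (block_familyM _ _ _ _ g_bij).
congr (_ *m _); apply: eq_block_family => t; apply: two_grid_blockE.
exact: block_family_unit uB t.
Qed.

End Iteration.

Theorem theorem3 (R : realType) (n M L : nat)
    (n_gt0 : (0 < n)%N) (M_gt0 : (0 < M)%N) (L_gt0 : (0 < L)%N)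
    (t0 dt : R) (dt_gt0 : 0 < dt)
    (tau : 'I_L -> 'I_M -> R) (tau_nodes : quadrature_nodes t0 dt tau)
    (Q : 'M[R]_M) (Q_quad : quadrature_matrix t0 dt tau Q)
    (QD : 'M[R]_M) (QD_lower : is_trig_mx QD)
    (A : 'M[R]_(n + n)) (A_circ : circulant A)
    (lamA : 'I_(n + n) -> R[i])
    (A_eig : forall k, toC A *m col k (fourier_mx R (n + n))
                       = lamA k *: col k (fourier_mx R (n + n)))
    (At : 'M[R]_n) (At_circ : circulant At)
    (lamAt : 'I_n -> R[i])
    (At_eig : forall k, toC At *m col k (fourier_mx R n)
                        = lamAt k *: col k (fourier_mx R n))
    (S : 'M[R]_(n + n, n)) (S_CI : CI_interpolation S)
    (Rst : 'M[R]_(n, n + n)) (Rst_CI : CI_restriction Rst)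
    (P_inv : composite_mx L dt QD A \in unitmx)
    (Pt_inv : composite_mx L dt QD At \in unitmx) :
  let BP (k : 'I_(n + n)) (j : 'I_L) := time_block dt QD (lamA k) j in
  let BM (k : 'I_(n + n)) (j : 'I_L) := time_block dt Q (lamA k) j in
  let BPt (k : 'I_n) (j : 'I_L) := time_block dt QD (lamAt k) j in
  let BS (k : 'I_n) (j : 'I_L) :=
    smoother_block (BP (lshift n k) j) (BM (lshift n k) j)
                   (BP (rshift n k) j) (BM (rshift n k) j) in
  let BCGC (k : 'I_n) (j : 'I_L) :=
    cgc_block (interp_d S k) (interp_dhat S k)
              (restr_f Rst k) (restr_fhat Rst k)
              (BPt k j) (BM (lshift n k) j) (BM (rshift n k) j) in
  [/\ exists F : 'M[R[i]]_(L * M * (n + n)),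
        transforms_into F (toC (iteration_mx L dt Q QD A At S Rst))
          (diag_blocks (pairs_dim L M n) (fun k j => BS k j *m BCGC k j)),
      exists s : 'S_(L * M * (n + n)),
        let F := fourier_layers R L M (n + n) *m perm_mx s in
        transforms_into F (toC (composite_mx L dt QD A))
          (diag_blocks (layers_dim L M (n + n)) BP)
        /\ transforms_into F (toC (composite_mx L dt Q A))
             (diag_blocks (layers_dim L M (n + n)) BM)
    & exists s : 'S_(L * M * n),
        transforms_into (fourier_layers R L M n *m perm_mx s)
          (toC (composite_mx L dt QD At))
          (diag_blocks (layers_dim L M n) BPt)].
Proof.
move=> BP BM BPt BS BCGC.
have PF := @composite_fourier R L M (n + n) dt QD A lamA L_gt0 A_eig.
have MF := @composite_fourier R L M (n + n) dt Q A lamA L_gt0 A_eig.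
have PtF := @composite_fourier R L M n dt QD At lamAt L_gt0 At_eig.
have uF N := fourier_layers_unit R L M N.
have g_bij N := @layer_coord_bij L M N.
rewrite !diag_blocksE; split.
- have TF := @iteration_fourier R L M n dt Q QD A At S Rst BP BM BPt
    S_CI Rst_CI P_inv Pt_inv PF MF PtF.
  have h_bij := diag_coord_bij (pairs_dim L M n).
  have p_bij := @pair_coord_bij L M n.
  have [s sE] := perm_block_family R[i] p_bij h_bij.
  exists (fourier_layers R L M (n + n) *m perm_mx s).
  exact: transforms_into_reindex p_bij h_bij sE (uF _) TF.
- have h_bij := diag_coord_bij (layers_dim L M (n + n)).
  have [s sE] := perm_block_family R[i] (g_bij _) h_bij.
  exists s; split.
    exact: transforms_into_reindex (g_bij _) h_bij sE (uF _) PF.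
  exact: transforms_into_reindex (g_bij _) h_bij sE (uF _) MF.
- have h_bij := diag_coord_bij (layers_dim L M n).
  have [s sE] := perm_block_family R[i] (g_bij _) h_bij.
  exists s; exact: transforms_into_reindex (g_bij _) h_bij sE (uF _) PtF.
Qed.
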